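(* Distributional chaos of type 3 (in the sense of the existence of an uncountable scrambled set) is not preserved by conjugacy. That is, there exist topologically conjugate topological dynamical systems $(X,f)$ and $(Y,F)$ on compact metric spaces such that $(Y,F)$ is distributionally chaotic of type 3 while $(X,f)$ is not.
   Context: A topological dynamical system $(X,f)$ consists of a non-empty compact metric space $(X,d)$ and a continuous map $f:X\to X$. Systems $(X,f)$ and $(Y,F)$ are topologically conjugate if there is a continuous bijection $\pi:X\to Y$ with $\pi\circ f=F\circ\pi$. For $(x_1,x_2)\in X^2$ and $\delta>0$ put $$\Phi_{(x_1,x_2)}(\delta)=\liminf_{m\to\infty}\frac1m\#\{0\le k\le m: d(f^k(x_1),f^k(x_2))<\delta\},$$ $$\Phi^*_{(x_1,x_2)}(\delta)=\limsup_{m\to\infty}\frac1m\#\{0\le k\le m: d(f^k(x_1),f^k(x_2))<\delta\}.$$ The pair is distributionally scrambled of type 3 if there are $0\le a<b\le \operatorname{diam}X$ such that $\Phi_{(x_1,x_2)}(\delta)<\Phi^*_{(x_1,x_2)}(\delta)$ for every $\delta\in(a,b)$. The system is distributionally chaotic of type 3 if there is an uncountable set $S\subset X$ such that every pair of distinct points of $S$ is distributionally scrambled of type 3. *)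

(* Defs.v *)
From HB Require Import structures.
From mathcomp Require Import all_boot all_order all_algebra.
From mathcomp Require Import all_classical all_reals all_analysis.

Set Implicit Arguments.
Unset Strict Implicit.
Unset Printing Implicit Defensive.

Import Order.TTheory GRing.Theory Num.Theory.

Local Open Scope classical_set_scope.
Local Open Scope ring_scope.

Definition dynamical_system (R : realType) (X : metricType R) (f : X -> X) : Prop :=
  [/\ [set: X] !=set0, compact [set: X] & continuous f].

Definition conjugate (R : realType) (X Y : metricType R)
    (f : X -> X) (F : Y -> Y) : Prop :=
  exists pi : X -> Y, [/\ continuous pi, bijective pi & pi \o f =1 F \o pi].

(* The supremum is taken in [R]; it is the diameter when the space is
   non-empty and bounded, in particular for every dynamical system. *)
Definition diameter (R : realType) (X : metricType R) : R :=
  sup [set r : R | exists x y : X, r = mdist x y].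

(* The index [k] ranges over 0, ..., m, so there are m + 1 times and the
   frequency is at most 2 for m >= 1; at m = 0 it is 0 because 0^-1 = 0,
   which does not affect the limits inferior and superior. *)
Definition frequency (R : realType) (X : metricType R) (f : X -> X)
    (x1 x2 : X) (delta : R) (m : nat) : R :=
  m%:R^-1 *
  #|[pred k : 'I_m.+1 | mdist (iter k f x1) (iter k f x2) < delta]|%:R.

(* [limn_inf] and [limn_sup] are real valued; they are the limit inferior and
   limit superior since [frequency] is bounded. *)
Definition lower_distribution (R : realType) (X : metricType R) (f : X -> X)
    (x1 x2 : X) (delta : R) : R :=
  limn_inf (frequency f x1 x2 delta).

Definition upper_distribution (R : realType) (X : metricType R) (f : X -> X)
    (x1 x2 : X) (delta : R) : R :=
  limn_sup (frequency f x1 x2 delta).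

Definition scrambled3 (R : realType) (X : metricType R) (f : X -> X)
    (x1 x2 : X) : Prop :=
  exists a b : R, [/\ 0 <= a, a < b, b <= diameter X &
    forall delta : R, a < delta < b ->
      lower_distribution f x1 x2 delta < upper_distribution f x1 x2 delta].

Definition distributionally_chaotic3 (R : realType) (X : metricType R)
    (f : X -> X) : Prop :=
  exists S : set X, ~ countable S /\
    forall x1 x2 : X, S x1 -> S x2 -> x1 <> x2 -> scrambled3 f x1 x2.

(* Main.v *)
(* Let C be the unit interval and u_n a sequence in [0, 1] with
   u_(n+1) - u_n -> 0 that stays at 0, respectively at 1, over arbitrarily late
   time blocks occupying 3/4 of the past. The points (1/(n+1), u_n) accumulate
   on the segment {0} x [0, 1]; together they form a compact set B. Moving each
   point of the sequence to the next one and fixing the segment is continuous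
   on B, because u_n moves slowly, and hence so is the map on B x C that keeps
   the C-coordinate.

   With the product metric the distance between two points above the sequence
   converges to |s - t|, and two points above the segment are fixed, so no such
   pair is scrambled and a scrambled set has at most two points. Rescaling the
   fibre above (a, u) by the factor 1 + u gives a bi-Lipschitz equivalent
   metric, for which two points s, t of the fibre above u_0 are at distance
   (1 + u_n)|s - t| at time n: the frequencies oscillate for every delta between
   |s - t| and 2|s - t|, and the whole fibre is scrambled. *)

Require Import Defs.
From HB Require Import structures.
From mathcomp Require Import all_boot all_order all_algebra.
From mathcomp Require Import all_classical all_reals all_analysis.
From mathcomp Require Import zify ring lra.

Set Implicit Arguments.
Unset Strict Implicit.
Unset Printing Implicit Defensive.

Import Order.TTheory GRing.Theory Num.Theory.
Import numFieldNormedType.Exports.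

Local Open Scope classical_set_scope.
Local Open Scope ring_scope.

(** * A slowly varying sequence with long plateaus at 0 and 1 *)

Section oscillation.
Variable R : realType.

Definition level (j : nat) : R := (odd j./2)%:R.

(* Affine on each block [4^j, 4^(j+1)], from [level j] to [level (j+1)]; the
   levels run through 0, 0, 1, 1 periodically. *)
Definition oscillation (n : nat) : R :=
  let j := trunc_log 4 n in
  level j + (n - 4 ^ j)%:R / (3 * 4 ^ j)%:R * (level j.+1 - level j).

Lemma level_itv j : 0 <= level j <= 1.
Proof. by rewrite /level ler0n; case: odd; rewrite ?ler01 ?lexx. Qed.

Lemma oscillation_itv n : 0 <= oscillation n <= 1.
Proof.
rewrite /oscillation; set j := trunc_log 4 n.
have nj : (n - 4 ^ j <= 3 * 4 ^ j)%N.
  by have := @trunc_log_ltn 4 n isT; rewrite -/j expnS; lia.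
have p0 : 0 < (3 * 4 ^ j)%:R :> R by rewrite ltr0n muln_gt0 expn_gt0.
have r0 : 0 <= (n - 4 ^ j)%:R / (3 * 4 ^ j)%:R :> R by rewrite divr_ge0// ltW.
have r1 : (n - 4 ^ j)%:R / (3 * 4 ^ j)%:R <= 1 :> R.
  by rewrite ler_pdivrMr// mul1r ler_nat.
have /andP[a0 a1] := level_itv j; have /andP[b0 b1] := level_itv j.+1.
move: (level j) (level j.+1) (_ / _) a0 a1 b0 b1 r0 r1 => a b r *.
by apply/andP; split; nra.
Qed.

Lemma oscillation_plateau j n : level j.+1 = level j ->
  (4 ^ j <= n < 4 ^ j.+1)%N -> oscillation n = level j.
Proof.
move=> jj nj; rewrite /oscillation (@trunc_log_eq 4 j)// jj.
by rewrite subrr mulr0 addr0.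
Qed.

(** For n > 0 in the block from 4^j to 4^(j+1), the slope is at most 1/(3 * 4^j) in size, and n + 1
    <= 4^(j+1) <= 2 * 3 * 4^j. If n + 1 opens the next block, the two affine pieces agree there. *)
Lemma oscillation_step n : `|oscillation n.+1 - oscillation n| <= 2 / n.+1%:R.
Proof.
case: n => [|n].
  rewrite /oscillation trunc_log0 trunc_log1 subnn sub0n !mul0r !addr0.
  by rewrite subrr normr0 divr_ge0.
set j := trunc_log 4 n.+1.
have /andP[jn nj] : (4 ^ j <= n.+1 < 4 ^ j.+1)%N by exact: trunc_log_bounds.
have q0 : (0 < 4 ^ j)%N by rewrite expn_gt0.
have p0 : 0 < (3 * 4 ^ j)%:R :> R by rewrite ltr0n muln_gt0 q0.
suff -> : oscillation n.+2 - oscillation n.+1 =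
    (level j.+1 - level j) / (3 * 4 ^ j)%:R.
  have lev : `|level j.+1 - level j| <= 1.
    have /andP[a0 a1] := level_itv j; have /andP[b0 b1] := level_itv j.+1.
    by rewrite ler_norml; apply/andP; split; lra.
  rewrite normrM [X in _ * X]gtr0_norm ?invr_gt0// ler_pdivrMr//.
  apply: (le_trans lev).
  rewrite mulrAC -natrM ler_pdivlMr ?ltr0n// mul1r ler_nat.
  by move: nj; rewrite expnS; lia.
have osc : oscillation n.+1 = level j +
  (n.+1 - 4 ^ j)%:R / (3 * 4 ^ j)%:R * (level j.+1 - level j) by [].
have [lt|ge] := ltnP n.+2 (4 ^ j.+1).
  have jj : trunc_log 4 n.+2 = j by apply: trunc_log_eq => //; rewrite lt andbT; lia.
  rewrite osc {1}/oscillation jj !natrB//; last by lia.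
  by rewrite -[n.+2]addn1 natrD; field; rewrite pnatr_eq0; lia.
have nE : n.+2 = (4 ^ j.+1)%N by lia.
have jj : trunc_log 4 n.+2 = j.+1 by rewrite nE trunc_expnK.
rewrite osc {1}/oscillation jj nE subnn !mul0r addr0 natrB//.
have -> : n.+1 = (4 ^ j.+1 - 1)%N by lia.
rewrite natrB ?expn_gt0// expnS !natrM.
by field; rewrite pnatr_eq0; lia.
Qed.

End oscillation.

(** * The space, its family of metrics, and their equivalence *)

Section cylinder.
Variable R : realType.

Definition unit_interval := {x : R | 0 <= x <= 1}.

(* [inl n] stands for the point (1/(n+1), u_n) of the plane, [inr v] for (0, v). *)
Definition base := (nat + unit_interval)%type.

Definition height (i : base) : R := if i is inl n then n.+1%:R^-1 else 0.

Definition phase (i : base) : R :=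
  match i with inl n => oscillation R n | inr v => val v end.

Definition step (i : base) : base :=
  match i with inl n => inl n.+1 | inr v => inr v end.

(** The body ignores [c]: all aliases are one set, and [c] lets each carry its own metric
    structure. *)
Definition cylinder (c : nat) := (base * unit_interval)%type.

Definition advance c (x : cylinder c) : cylinder c := (step x.1, x.2).

(* The parameter [c] selects the metric: [c = 0] is the product metric, [c = 1]
   the one with the fibres rescaled by 1 + u. *)
Definition embed c (x : cylinder c) : R := (1 + c%:R * phase x.1) * val x.2.

(** The l1 metric of R^3 pulled back along [height], [phase] and [embed]. *)
Definition cylinder_dist c (x y : cylinder c) : R :=
  `|height x.1 - height y.1| + `|phase x.1 - phase y.1| + `|embed x - embed y|.

Lemma unit_interval_itv (v : unit_interval) : 0 <= val v <= 1.
Proof. by case: v. Qed.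

Lemma phase_itv i : 0 <= phase i <= 1.
Proof. by case: i => [n|v]; [exact: oscillation_itv|exact: unit_interval_itv]. Qed.

Lemma height_ge0 i : 0 <= height i.
Proof. by case: i => //= n; rewrite invr_ge0. Qed.

Lemma base_inj i j : height i = height j -> phase i = phase j -> i = j.
Proof.
case: i j => [n|v] [m|w] //=.
- by move/invr_inj/eqP; rewrite eqr_nat eqSS => /eqP->.
- by move/eqP; rewrite invr_eq0 pnatr_eq0.
- by move/esym/eqP; rewrite invr_eq0 pnatr_eq0.
- by move=> _ /val_inj ->.
Qed.

Section metric.
Variable c : nat.
Implicit Types x y z : cylinder c.

Lemma scale_ge1 i : 1 <= 1 + c%:R * phase i.
Proof. by rewrite lerDl mulr_ge0//; case/andP: (phase_itv i). Qed.

Let distxx x : cylinder_dist x x = 0.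
Proof. by rewrite /cylinder_dist !subrr !normr0 !addr0. Qed.

Let dist_positivity x y : cylinder_dist x y = 0 -> x = y.
Proof.
case: x y => [i s] [j t]; rewrite /cylinder_dist/=.
move/eqP; rewrite !paddr_eq0 ?addr_ge0// !normr_eq0 !subr_eq0.
move=> /andP[/andP[/eqP hij /eqP pij]]; rewrite /embed/= (base_inj hij pij).
rewrite (inj_eq (mulfI _)); last first.
  by rewrite gt_eqF// (lt_le_trans ltr01 (scale_ge1 _)).
by move=> /eqP/val_inj ->.
Qed.

Let dist_sym x y : cylinder_dist x y = cylinder_dist y x.
Proof. by rewrite /cylinder_dist ![`|_ x.1 - _|]distrC [`|embed x - _|]distrC. Qed.

Let dist_triangle y x z :
  cylinder_dist x z <= cylinder_dist x y + cylinder_dist y z.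
Proof.
rewrite /cylinder_dist.
have := ler_distD (height y.1) (height x.1) (height z.1).
have := ler_distD (phase y.1) (phase x.1) (phase z.1).
have := ler_distD (embed y) (embed x) (embed z).
by lra.
Qed.

HB.instance Definition _ := Choice.on (cylinder c).
HB.instance Definition _ := @isMetric.Build R (cylinder c)
  (@cylinder_dist c) distxx dist_positivity dist_sym dist_triangle.

Lemma cylinder_mdistE x y : mdist x y = cylinder_dist x y.
Proof. by []. Qed.

End metric.

(** The estimate only involves a fixed centre, so [C] and [e0] may depend on [x]. Balls in the
    domain make it apply to [R^o] and its square as well. *)
Lemma locally_lipschitz_continuous (U : pseudoMetricType R) (V : metricType R)
    (f : U -> V) :
  (forall x, exists C e0 : R, [/\ 0 < C, 0 < e0 &
     forall y (e : R), 0 < e -> e <= e0 -> ball x e y ->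
       mdist (f x) (f y) <= C * e]) -> continuous f.
Proof.
move=> H x; have [C [e0 [C0 e00 lip]]] := H x.
apply/metricType_numDomainType.cvgrPdist_le => eps eps0.
pose e := Num.min e0 (eps / C).
have e_gt0 : 0 < e by rewrite lt_min e00 divr_gt0.
near=> y; apply: le_trans (lip y e _ _ _) _ => //.
- by rewrite ge_min lexx.
- by near: y; exact: nbhsx_ballx.
- by rewrite -ler_pdivlMl// mulrC ge_min lexx orbT.
Unshelve. all: by end_near. Qed.

Lemma embed_dist c (x y : cylinder c) :
  `|embed x - embed y| <= c%:R * `|phase x.1 - phase y.1| +
    (1 + c%:R) * `|val x.2 - val y.2|.
Proof.
have -> : embed x - embed y = c%:R * (phase x.1 - phase y.1) * val x.2 +
   (1 + c%:R * phase y.1) * (val x.2 - val y.2).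
  by rewrite /embed; ring.
have := unit_interval_itv x.2; have := phase_itv y.1.
move: (phase _) (phase _) (val x.2) (val y.2) => p q s t /andP[q0 q1] /andP[s0 s1].
apply: le_trans (ler_normD _ _) _; rewrite !normrM [`|c%:R|]ger0_norm//.
rewrite (ger0_norm s0) [`|1 + _|]ger0_norm ?addr_ge0 ?mulr_ge0//; apply: lerD.
  by rewrite ler_piMr ?mulr_ge0.
by rewrite ler_wpM2r// lerD2l ler_piMr.
Qed.

(** The scale factor is at least 1, so undoing it does not enlarge distances; the term in [c] pays
    for the differing phases. *)
Lemma snd_dist c (x y : cylinder c) :
  `|val x.2 - val y.2| <= (1 + c%:R) * mdist x y.
Proof.
have : `|(1 + c%:R * phase x.1) * (val x.2 - val y.2)| <=
    `|embed x - embed y| + c%:R * `|phase x.1 - phase y.1|.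
  have -> : (1 + c%:R * phase x.1) * (val x.2 - val y.2) = embed x - embed y
     - c%:R * (phase x.1 - phase y.1) * val y.2 by rewrite /embed; ring.
  apply: le_trans (ler_normB _ _) _; rewrite lerD2l !normrM ger0_norm//.
  have /andP[s0 s1] := unit_interval_itv y.2.
  by rewrite ler_piMr ?mulr_ge0// ger0_norm.
rewrite normrM (ger0_norm (le_trans ler01 (scale_ge1 c _))).
have : `|val x.2 - val y.2| <= (1 + c%:R * phase x.1) * `|val x.2 - val y.2|.
  by rewrite ler_peMl// scale_ge1.
move=> /le_trans H /H; rewrite cylinder_mdistE /cylinder_dist.
have := normr_ge0 (height x.1 - height y.1).
have := normr_ge0 (phase x.1 - phase y.1).
have := normr_ge0 (embed x - embed y).
have : 0 <= c%:R :> R by [].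
move: (c%:R : R) `|_| `|_| `|_| `|_| => C a b d e *; nra.
Qed.

(** The height and phase terms are the same in both metrics. The new [embed] term is bounded by
    [embed_dist], and the fibre difference in it by [snd_dist]. *)
Lemma continuous_rescale c c' :
  continuous (fun x : cylinder c => x : cylinder c').
Proof.
apply: locally_lipschitz_continuous => x.
exists (1 + 1 + c'%:R + (1 + c'%:R) * (1 + c%:R)), 1.
have cc : 0 <= (1 + c'%:R) * (1 + c%:R) :> R by rewrite mulr_ge0 ?addr_ge0.
split=> [||y e e0 _]; [by rewrite ltr_wpDr// ltr_wpDr|by []|].
rewrite ballEmdist/= => /ltW xye.
have := embed_dist (x : cylinder c') y; have := snd_dist x y.
have : mdist x y <= e by [].
rewrite !cylinder_mdistE /cylinder_dist.
have := normr_ge0 (height x.1 - height y.1).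
have := normr_ge0 (phase x.1 - phase y.1).
have := normr_ge0 (embed x - embed y).
have : 0 <= c%:R :> R by [].
have : 0 <= c'%:R :> R by [].
set h := `|height _ - _|; set p := `|phase _ - _|; set E := `|_ - _|.
set s := `|_ - _|; set E' := `|_ - _|.
move: (c%:R : R) (c'%:R : R) h p E E' s.
move=> C C' h p E E' s C0 C0' E0 p0 h0 le1 le2 le3.
have : (1 + C') * s <= (1 + C') * (1 + C) * e.
  by rewrite -mulrA ler_wpM2l ?addr_ge0// (le_trans le2)// ler_wpM2l ?addr_ge0.
have : C' * p <= C' * e by rewrite ler_wpM2l//; lra.
lra.
Qed.

End cylinder.

(** * Continuity of the map and long-time behaviour of its orbits *)

Section dynamics.
Variable R : realType.
Local Notation cylinder := (cylinder R).
Local Notation unit_interval := (unit_interval R).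

(** Slow oscillation makes the displacement vanish with the height, which gives continuity at the
    fixed points. *)
Lemma advance_displacement c (x : cylinder c) :
  mdist x (advance x) <= (3 + 2 * c%:R) * height x.1.
Proof.
have h0 := height_ge0 x.1.
have hd : `|height x.1 - height (step x.1)| <= height x.1.
  case: (x.1) => [n|v] /=; last by rewrite subrr normr0.
  have le : n.+2%:R^-1 <= n.+1%:R^-1 :> R by rewrite lef_pV2 ?posrE// ler_nat.
  by rewrite ger0_norm ?subr_ge0// lerBlDr lerDl.
have pd : `|phase x.1 - phase (step x.1)| <= 2 * height x.1.
  case: (x.1) => [n|v] /=; first by rewrite distrC oscillation_step.
  by rewrite subrr normr0 mulr0.
have := embed_dist x (advance x); rewrite /= subrr normr0 mulr0 addr0 => ed.
have : c%:R * `|phase x.1 - phase (step x.1)| <= c%:R * (2 * height x.1).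
  by rewrite ler_wpM2l.
by rewrite cylinder_mdistE /cylinder_dist/=; lra.
Qed.

(** The bound equals 1/(n+1) - 1/(n+2), the distance to the nearest other height. *)
Lemma height_isolated n i :
  `|height (inl n) - height i| < (n.+1%:R * n.+2%:R)^-1 :> R -> i = inl n.
Proof.
have gap (a b : R) : 0 < a -> 0 < b -> b <= a -> b <= n.+2%:R -> a <= n.+2%:R ->
    (a <= n.+1%:R \/ b <= n.+1%:R) -> 1 <= a - b ->
    (n.+1%:R * n.+2%:R)^-1 <= b^-1 - a^-1.
  move=> a0 b0 ba bn an ab ab1.
  have -> : b^-1 - a^-1 = (a - b) / (a * b) by field; rewrite !gt_eqF.
  apply: le_trans (_ : (a * b)^-1 <= _); last first.
    by rewrite ler_peMl// invr_ge0 mulr_ge0// ltW.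
  rewrite lef_pV2 ?posrE ?mulr_gt0//.
  by case: ab => ab; [|rewrite mulrC]; apply: ler_pM => //; exact: ltW.
have far : (n.+1%:R * n.+2%:R)^-1 <= n.+1%:R^-1 - n.+2%:R^-1 :> R.
  apply: gap => //; rewrite ?ler_nat//; try lia.
  by rewrite -natrB// subSnn.
case: i => [m|v] /= lt; last first.
  exfalso; move: lt; rewrite subr0 ger0_norm// ltNge => /negP; apply.
  by apply: le_trans far _; rewrite lerBlDr lerDl.
have [mn|nm|->//] := ltngtP m n; exfalso.
  move: lt; rewrite distrC ltNge => /negP; apply; apply: le_trans (ler_norm _).
  apply: gap => //; rewrite ?ler_nat//; try lia.
  by rewrite -natrB ?ler1n; lia.
move: lt; rewrite ltNge => /negP; apply; apply: le_trans (ler_norm _).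
apply: le_trans far _; rewrite lerB// lef_pV2 ?posrE// ler_nat; lia.
Qed.

Lemma advance_continuous c : continuous (@advance R c).
Proof.
apply: locally_lipschitz_continuous => -[[n|v] s].
  (* Within this radius the point stays in the same isolated fibre. One factor comes from
     [embed_dist], the other from [snd_dist]. *)
  exists ((1 + c%:R) * (1 + c%:R)), (n.+1%:R * n.+2%:R)^-1.
  split=> [||[i t] e e0 en]; [by rewrite mulr_gt0// ltr_pwDl|by []|].
  rewrite ballEmdist/= => xye.
  have : i = inl n.
    apply: height_isolated; apply: lt_le_trans en; apply: le_lt_trans xye.
    by rewrite cylinder_mdistE /cylinder_dist/= -addrA lerDl addr_ge0.
  move=> iE; rewrite {}iE in xye *; rewrite cylinder_mdistE /cylinder_dist/=.
  rewrite !subrr !normr0 !add0r.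
  apply: le_trans (embed_dist _ _) _; rewrite /= subrr normr0 mulr0 add0r.
  rewrite -mulrA; apply: ler_wpM2l; first by rewrite addr_ge0.
  apply: le_trans (snd_dist (inl n, s) (inl n, t)) _.
  by apply: ler_wpM2l; [rewrite addr_ge0|exact: ltW].
(* A limit point x is fixed, so its image is within d(x, y) plus the displacement of y, which is at
   most 3 + 2c times the height of y, itself at most d(x, y). *)
exists (4 + 2 * c%:R), 1; split=> [||y e e0 _]; [by rewrite ltr_wpDr|by []|].
rewrite ballEmdist/= => /ltW xye.
have -> : advance ((inr v, s) : cylinder c) = (inr v, s) by [].
apply: le_trans (metric_triangle _ y _) _.
have hy : height y.1 <= mdist ((inr v, s) : cylinder c) y.
  rewrite cylinder_mdistE /cylinder_dist/= sub0r normrN ger0_norm ?height_ge0//.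
  by rewrite -addrA lerDl addr_ge0.
have := advance_displacement y.
have : (3 + 2 * c%:R) * height y.1 <= (3 + 2 * c%:R) * e.
  by rewrite ler_wpM2l ?addr_ge0// (le_trans hy).
lra.
Qed.

Lemma iter_advance_inl c n s k :
  iter k (@advance R c) (inl n, s) = (inl (n + k)%N, s).
Proof. by elim: k => [|k IH]; rewrite ?addn0// iterS IH addnS. Qed.

Lemma iter_advance_inr c v s k : iter k (@advance R c) (inr v, s) = (inr v, s).
Proof. by elim: k => // k IH; rewrite iterS IH. Qed.

(** Telescoping: each of the [n] steps from time [k] on costs at most 2/(k+1). Hence orbits started
    at different indices share their phase asymptotically. *)
Lemma oscillation_shift n k :
  `|oscillation R (n + k) - oscillation R k| <= 2 * n%:R / k.+1%:R.
Proof.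
elim: n => [|n IH]; first by rewrite add0n subrr normr0 mulr0 mul0r.
apply: le_trans (ler_distD (oscillation R (n + k)) _ _) _.
rewrite addSn -(natr1 n) mulrDr mulr1 mulrDl addrC lerD//.
apply: le_trans (oscillation_step _ _) _.
by rewrite ler_pM2l// lef_pV2 ?posrE// ler_nat; lia.
Qed.

(** In the flat metric the fibre term is constant, and the height and phase terms are O(1/k). *)
Lemma dist_inl_cvg n m (s t : unit_interval) :
  (mdist (iter k (@advance R 0) (inl n, s)) (iter k (@advance R 0) (inl m, t)))
    @[k --> \oo] --> `|val s - val t|.
Proof.
apply/(@cvgrPdist_le _ R^o) => /= eps eps0.
near=> k.
rewrite !iter_advance_inl cylinder_mdistE /cylinder_dist /embed/=.
rewrite !mul0r !addr0 !mul1r distrC addrK.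
have hk j : 0 <= ((j + k).+1%:R^-1 : R) <= k.+1%:R^-1.
  by rewrite invr_ge0 ler0n lef_pV2 ?posrE// ler_nat; lia.
have osc := oscillation_shift n k; have osc' := oscillation_shift m k.
have K : (1 + 2 * n%:R + 2 * m%:R) / k.+1%:R <= eps.
  rewrite ler_pdivrMr// [leRHS]mulrC -ler_pdivrMr//.
  apply: le_trans (_ : (k%:R : R) <= _); last by rewrite (ler_nat R).
  by near: k; exact: nbhs_infty_ger.
rewrite ger0_norm ?addr_ge0//; apply: le_trans K.
have : `|(n + k).+1%:R^-1 - (m + k).+1%:R^-1| <= k.+1%:R^-1 :> R.
  have /andP[a0 a1] := hk n; have /andP[b0 b1] := hk m.
  move: (_^-1) (_^-1) (_^-1) a0 a1 b0 b1 => a b d *.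
  by rewrite ler_norml; apply/andP; split; lra.
have := ler_distD (oscillation R k) (oscillation R (n + k)) (oscillation R (m + k)).
rewrite [`|_ k - _|]distrC => tri hd.
rewrite -[1 + _ + _]addrA [leRHS]mulrDl mul1r [(2 * _ + _) * _]mulrDl.
by apply: lerD => //; apply: le_trans tri _; apply: lerD.
Unshelve. all: by end_near. Qed.

End dynamics.

(** * Compactness of the space *)

Section compactness.
Variable R : realType.
Variable c : nat.
Local Notation cylinder := (cylinder R c).
Local Notation unit_interval := (unit_interval R).

Lemma clamp_itv (x : R) : 0 <= Num.max 0 (Num.min x 1) <= 1.
Proof. by rewrite le_max lexx/= ge_max ler01 ge_min lexx orbT. Qed.

(** A 1-Lipschitz retraction of the line, used to parametrise fibres by real segments. *)
Definition clamp (x : R) : unit_interval :=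
  exist (fun y : R => is_true (0 <= y <= 1)) _ (clamp_itv x).

Lemma clampK (v : unit_interval) : clamp (val v) = v.
Proof.
apply: val_inj => /=; have /andP[v0 v1] := unit_interval_itv v.
by rewrite min_l// max_r.
Qed.

Lemma clamp_dist (x y : R) : `|val (clamp x) - val (clamp y)| <= `|x - y|.
Proof.
have clampE z : [\/ val (clamp z) = 0 /\ z <= 0,
    val (clamp z) = z /\ 0 <= z <= 1 | val (clamp z) = 1 /\ 1 <= z].
  rewrite /=; have [z1|z1] := leP z 1; have [z0|z0] := ltP 0 z.
  - by constructor 2; rewrite ltW.
  - by constructor 1.
  - by constructor 3; rewrite max_r// ltW.
  - by constructor 3; rewrite max_r// ltW.
have := ler_norm (x - y); have := ler_norm (y - x); rewrite [`|y - x|]distrC.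
move: `|x - y| (clampE x) (clampE y) => d cx cy d1 d2.
by rewrite ler_norml; case: cx => -[-> ?]; case: cy => -[-> ?]; apply/andP; split; lra.
Qed.

Let fibre_compact n : compact [set x : cylinder | x.1 = inl n].
Proof.
pose g (s : R^o) : cylinder := (inl n, clamp s).
have -> : [set x : cylinder | x.1 = inl n] = g @` `[0, 1].
  apply/seteqP; split => [[i s]/= ->|_ [s _ <-]//].
  by exists (val s); rewrite ?/g ?clampK//= in_itv/= unit_interval_itv.
apply: continuous_compact; last exact: segment_compact.
apply: continuous_subspaceT; apply: locally_lipschitz_continuous => x.
exists (1 + c%:R), 1; split=> [||y e e0 _]; [by rewrite ltr_pwDl|by []|].
rewrite /ball/= => /ltW xye.
rewrite cylinder_mdistE /cylinder_dist/= !subrr !normr0 !add0r.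
apply: le_trans (embed_dist _ _) _; rewrite /= subrr normr0 mulr0 add0r.
apply: ler_wpM2l; first by rewrite addr_ge0.
exact: le_trans (clamp_dist _ _) xye.
Qed.

Let limit_compact : compact [set x : cylinder | height x.1 = 0].
Proof.
pose g (p : R^o * R^o) : cylinder := (inr (clamp p.1), clamp p.2).
have -> : [set x : cylinder | height x.1 = 0] = g @` (`[0, 1] `*` `[0, 1]).
  apply/seteqP; split => [[[n|v] s]/= h0|_ [s _ <-]//].
    by move/eqP: h0; rewrite invr_eq0 pnatr_eq0.
  exists (val v, val s); rewrite ?/g ?clampK//=.
  by split; rewrite /= in_itv/= unit_interval_itv.
apply: continuous_compact; last by apply: compact_setX; exact: segment_compact.
apply: continuous_subspaceT; apply: locally_lipschitz_continuous => x.
exists (1 + c%:R + (1 + c%:R)), 1.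
split=> [||y e e0 _]; [by rewrite addr_gt0// ltr_pwDl|by []|].
move=> [/= /ltW xye1 /ltW xye2].
rewrite cylinder_mdistE /cylinder_dist/= !subrr !normr0 !add0r.
have ph : `|val (clamp x.1) - val (clamp y.1)| <= e.
  exact: le_trans (clamp_dist _ _) xye1.
have ed := embed_dist (g x) (g y).
have : c%:R * `|val (clamp x.1) - val (clamp y.1)| <= c%:R * e.
  by apply: ler_wpM2l.
have : (1 + c%:R) * `|val (clamp x.2) - val (clamp y.2)| <= (1 + c%:R) * e.
  by apply: ler_wpM2l; [rewrite addr_ge0|exact: le_trans (clamp_dist _ _) xye2].
move: ed ph; rewrite /g/=; lra.
Qed.

(** Phase and [embed] are preserved, so a point moves by exactly its height; [clamp] merely
    repackages a phase already in [0, 1]. *)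
Let project (x : cylinder) : cylinder := (inr (clamp (phase x.1)), x.2).

Let project_dist (x : cylinder) : mdist (project x) x = height x.1.
Proof.
rewrite cylinder_mdistE /cylinder_dist /embed/=.
have /andP[p0 p1] := phase_itv x.1.
by rewrite min_l// max_r// !subrr !normr0 !addr0 sub0r normrN ger0_norm// height_ge0.
Qed.

(* A filter either clusters in one of the isolated fibres, or it contains every
   neighbourhood of the limit square, onto which it can be projected. *)
Lemma cylinder_compact : compact [set: cylinder].
Proof.
move=> F FF _.
have [[n Fn]|/forallNP Fn] :=
    pselect (exists n, ~ F (~` [set x : cylinder | x.1 = inl n])).
  pose B := [set x : cylinder | x.1 = inl n].
  have FB : ProperFilter (within B F).
    apply: Build_ProperFilter_ex => // P FP; apply: contrapT => P0; apply: Fn.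
    have {}FP : F [set x | B x -> P x] by [].
    by apply: filterS FP => x BPx /BPx Px; apply: P0; exists x.
  have [p [_ clp]] := fibre_compact FB (withinT _ _).
  exists p; split=> // A C FA; apply: clp.
  by apply: filterS FA => x.
(* Every isolated fibre has its complement in [F]; discarding the fibres 0, ..., n in turn leaves
   only heights below 1/(n+1). *)
have Fh n : F [set x : cylinder | height x.1 < n.+1%:R^-1].
  elim: n => [|n IH].
    have /contrapT := Fn 0%N; apply: filterS => -[[[|n]|v] s]//= _.
      by rewrite ltf_pV2 ?posrE// ltr_nat.
  have /contrapT := Fn n.+1; move: IH; apply: filterS2 => -[[m|v] s]//=.
  rewrite !ltf_pV2 ?posrE// !ltr_nat => nm mn.
  have : m <> n.+1 by move=> mE; apply: mn; rewrite mE.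
  lia.
have [|p [_ clp]] := limit_compact (fmap_proper_filter project FF).
  exact: (@filterE _ F).
exists p; split=> // A B FA /nbhs_ballP[e /= e0 peB].
have e20 : 0 < e / 2 by rewrite divr_gt0.
have FAh : F (A `&` [set x : cylinder | height x.1 < e / 2]).
  apply: filterI => //; pose n := Num.bound (e / 2)^-1.
  apply: filterS (Fh n) => x /= /lt_trans; apply.
  rewrite invf_plt ?posrE//.
  apply: lt_le_trans (archi_boundP _) _; first by rewrite invr_ge0 ltW.
  by rewrite ler_nat.
have [||_ [[x [Ax /= hx] <-] pqx]] :=
    clp (project @` (A `&` [set x | height x.1 < e / 2])) (ball p (e / 2)).
- by apply: (@filterS _ F _ _ _ _ FAh) => x Ax; exists x.
- exact: nbhsx_ballx.
exists x; split=> //; apply: peB.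
rewrite [e]splitr; apply: ball_triangle pqx _.
by rewrite ballEmdist/= project_dist.
Qed.

End compactness.

(** * Convergent distances exclude scrambling *)

Section frequencies.
Variables (R : realType) (X : metricType R) (f : X -> X).

Definition close x1 x2 (delta : R) k := mdist (iter k f x1) (iter k f x2) < delta.

Lemma frequencyE x1 x2 delta m : frequency f x1 x2 delta m =
  m%:R^-1 * \sum_(k < m.+1) (close x1 x2 delta k)%:R.
Proof.
rewrite /frequency -sum1_card natr_sum big_mkcond/=; congr (_ * _).
by apply: eq_bigr => k _; rewrite inE /close; case: ifP.
Qed.

(** The count runs over m + 1 times but is divided by m, hence the correction (m + 1)/m to the
    Cesaro mean. *)
Lemma frequency_mean x1 x2 delta m : (0 < m)%N -> frequency f x1 x2 delta m =
  arithmetic_mean (fun k => (close x1 x2 delta k)%:R) m * (1 + m%:R^-1).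
Proof.
move=> m0; rewrite frequencyE /arithmetic_mean /series/= big_mkord.
by field; rewrite nat1r !pnatr_eq0 -lt0n m0.
Qed.

Lemma frequency_bounded x1 x2 delta :
  bounded_fun (frequency f x1 x2 delta : R^o^nat).
Proof.
exists 2; split=> // M M2 m _ /=; apply: le_trans (ltW M2).
rewrite /frequency ger0_norm ?mulr_ge0//.
case: m => [|m]; first by rewrite invr0 mul0r.
rewrite mulrC ler_pdivrMr// -natrM ler_nat.
by apply: leq_trans (max_card _) _; rewrite card_ord; lia.
Qed.

(** Away from the threshold [l] the closeness indicator is eventually constant, so its Cesaro means
    converge. *)
Lemma frequency_cvg x1 x2 delta (l : R) :
  (mdist (iter k f x1) (iter k f x2)) @[k --> \oo] --> l -> delta != l ->
  cvgn (frequency f x1 x2 delta).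
Proof.
move=> dl ne.
pose u k : R := (close x1 x2 delta k)%:R.
have ul : u @ \oo --> ((l < delta)%R%:R : R).
  apply: cvg_near_cst.
  have [lt|gt|eq] := ltgtP l delta; last by rewrite eq eqxx in ne.
    have : \forall k \near \oo, mdist (iter k f x1) (iter k f x2) < delta.
      exact: cvgr_lt dl _ lt.
    by apply: filterS => k; rewrite /u /close => ->.
  have : \forall k \near \oo, delta < mdist (iter k f x1) (iter k f x2).
    exact: cvgr_gt dl _ gt.
  by apply: filterS => k lt; rewrite /u /close ltNge (ltW lt).
have c1 : (fun m => 1 + m%:R^-1 : R) @ \oo --> (1 + 0 : R).
  apply: cvgD; first exact: cvg_cst.
  by rewrite -(cvg_shiftS (fun m => m%:R^-1 : R)); exact: cvg_harmonic.
apply/cvg_ex; exists ((l < delta)%R%:R * (1 + 0) : R).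
apply: cvg_trans (cvgM (cesaro ul) c1).
apply: near_eq_cvg; exists 1%N => // m /= m0.
by rewrite [RHS]frequency_mean.
Qed.

(** Only the threshold [l] can separate the two limits, whereas scrambling asks for a gap on a whole
    interval. *)
Lemma not_scrambled_cvg x1 x2 (l : R) :
  (mdist (iter k f x1) (iter k f x2)) @[k --> \oo] --> l ->
  ~ scrambled3 f x1 x2.
Proof.
move=> dl [a [b [_ ab _ scr]]].
have [delta [dab dnl]] : exists delta : R, a < delta < b /\ delta != l.
  have [eq|ne] := eqVneq l ((a + b) / 2).
    exists ((3 * a + b) / 4); rewrite eq; split; first by apply/andP; split; lra.
    by rewrite lt_eqF//; lra.
  by exists ((a + b) / 2); rewrite eq_sym ne; split=> //; apply/andP; split; lra.
have := scr _ dab; rewrite /lower_distribution /upper_distribution.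
have fc := frequency_cvg dl dnl.
by rewrite cvg_limn_infE// cvg_limn_supE// ltxx.
Qed.

End frequencies.

(** * Bounds on limits along a subsequence, and counting of times *)

Lemma limn_inf_le (R : realType) (u : R^o^nat) (x : R) : bounded_fun u ->
  (forall N, exists2 n, (N <= n)%N & u n <= x) -> limn_inf u <= x.
Proof.
move=> bu ux; rewrite limn_infE//; apply: ge_sup.
  by exists (infs u 0%N); exists 0%N.
move=> _ [N _ <-]; have [n Nn unx] := ux N; apply: le_trans unx.
apply: ge_inf; last by exists n.
by apply: has_lbound_sdrop; exact: bounded_fun_has_lbound.
Qed.

Lemma limn_sup_ge (R : realType) (u : R^o^nat) (x : R) : bounded_fun u ->
  (forall N, exists2 n, (N <= n)%N & x <= u n) -> x <= limn_sup u.
Proof.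
move=> bu ux; rewrite limn_supE//; apply: lb_le_inf.
  by exists (sups u 0%N); exists 0%N.
move=> _ [N _ <-]; have [n Nn unx] := ux N; apply: (le_trans unx).
apply: ub_le_sup; last by exists n.
by apply: has_ubound_sdrop; exact: bounded_fun_has_ubound.
Qed.

Lemma card_ord_lt M q : (q <= M)%N -> #|[pred k : 'I_M | (k < q)%N]| = q.
Proof.
move=> qM; rewrite -sum1_card -(big_mkord (fun k => k < q)%N (fun=> 1%N)).
by rewrite -(big_nat_widen 0 q M xpredT (fun=> 1%N))// sum_nat_const_nat muln1 subn0.
Qed.

Lemma card_ord_ge M q : (q <= M)%N -> #|[pred k : 'I_M | (q <= k)%N]| = (M - q)%N.
Proof.
move=> qM; have := cardC [pred k : 'I_M | (k < q)%N].
rewrite card_ord_lt// card_ord => qcM; rewrite -[X in _ = (X - _)%N]qcM addKn.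
by apply: eq_card => k; rewrite !inE -leqNgt.
Qed.

(** * The flat system is not chaotic, the stretched one is *)

Section chaos.
Variable R : realType.
Local Notation unit_interval := (unit_interval R).
Local Notation stretched := (cylinder R 1).

Lemma not_chaotic_flat : ~ distributionally_chaotic3 (@advance R 0).
Proof.
move=> [S [+ scr]]; apply; apply/countable_injP.
(* Two points with the same value are both moving or both fixed, so their distance converges and
   they cannot be scrambled. *)
exists (fun x : cylinder R 0 => if x.1 is inl _ then 0%N else 1%N).
move=> x1 x2; rewrite !inE => S1 S2 eq12; apply: contrapT => ne.
have := scr _ _ S1 S2 ne; move: eq12 {S1 S2 ne}.
case: x1 x2 => [[n|v] s] [[m|w] t]//= _.
  by apply: not_scrambled_cvg; exact: dist_inl_cvg.
apply: (@not_scrambled_cvg _ _ _ _ _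
  (mdist ((inr v, s) : cylinder R 0) (inr w, t))).
under eq_fun do rewrite !iter_advance_inr.
exact: cvg_cst.
Qed.

Lemma stretched_dist (s t : unit_interval) k :
  mdist (iter k (@advance R 1) (inl 0%N, s)) (iter k (@advance R 1) (inl 0%N, t))
    = (1 + oscillation R k) * `|val s - val t|.
Proof.
rewrite !iter_advance_inl add0n cylinder_mdistE /cylinder_dist /embed/=.
rewrite !subrr !normr0 !add0r mul1r -mulrBr normrM ger0_norm//.
by rewrite addr_ge0//; case/andP: (oscillation_itv R k).
Qed.

Lemma embed_itv (x : stretched) : 0 <= embed x <= 2.
Proof.
rewrite /embed mul1r; have := phase_itv x.1; have := unit_interval_itv x.2.
by move=> /andP[? ?] /andP[? ?]; apply/andP; split; nra.
Qed.

Lemma height_itv (i : base R) : 0 <= height i <= 1.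
Proof.
by rewrite height_ge0/=; case: i => [n|v] //=; rewrite invf_le1// ler1n.
Qed.

Lemma le_diameter_stretched (x y : stretched) : mdist x y <= diameter stretched.
Proof.
apply: ub_le_sup; last by exists x, y.
exists 4 => _ [z [w ->]]; rewrite cylinder_mdistE /cylinder_dist.
have /andP[? ?] := height_itv z.1; have /andP[? ?] := height_itv w.1.
have /andP[? ?] := phase_itv z.1; have /andP[? ?] := phase_itv w.1.
have /andP[? ?] := embed_itv z; have /andP[? ?] := embed_itv w.
have : `|height z.1 - height w.1| <= 1.
  by rewrite ler_norml; apply/andP; split; lra.
have : `|phase z.1 - phase w.1| <= 1.
  by rewrite ler_norml; apply/andP; split; lra.
have : `|embed z - embed w| <= 2.
  by rewrite ler_norml; apply/andP; split; lra.
lra.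
Qed.

Lemma block_size j : ((4 ^ j.+1).-1.+1 = 4 ^ j.+1)%N.
Proof. by rewrite prednK// expn_gt0. Qed.

Lemma stretched_lower (s t : unit_interval) delta :
    delta < 2 * `|val s - val t| ->
  lower_distribution (@advance R 1) (inl 0%N, s) (inl 0%N, t) delta <= 1 / 3.
Proof.
move=> dlt; apply: limn_inf_le; first exact: frequency_bounded.
(* Here j/2 = 2N + 1 is odd, so block [j] is a plateau at level 1, with last time 4^(j+1) - 1. Up to
   then only the 4^j times before the block can be close, and 4^j / (4^(j+1) - 1) <= 1/3. *)
move=> N; pose j := (4 * N + 2)%N.
have jN : (N < 4 ^ j)%N by apply: leq_trans (ltn_expl j _) => //; rewrite /j; lia.
have lj : level R j = 1.
  rewrite /level; have -> : (j./2 = N.*2.+1)%N by rewrite /j; lia.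
  by rewrite /= odd_double.
have ljj : level R j.+1 = level R j.
  by rewrite /level; have -> : (j.+1./2 = j./2)%N by rewrite /j; lia.
exists (4 ^ j.+1).-1; first by rewrite expnS; lia.
rewrite /frequency ler_pdivrMl ?ltr0n; last by rewrite expnS; lia.
rewrite mulrA mulr1 ler_pdivlMr// -natrM ler_nat.
apply: (@leq_trans (4 ^ j * 3)%N); last by rewrite expnS; lia.
rewrite leq_mul2r/= -[leqRHS](@card_ord_lt (4 ^ j.+1).-1.+1); last first.
  by rewrite block_size leq_exp2l.
apply: subset_leq_card; apply/fintype.subsetP => k; rewrite !inE; apply: contraLR.
rewrite -leqNgt -leNgt => jk; rewrite stretched_dist (oscillation_plateau ljj).
  by rewrite lj ltW.
by rewrite jk (leq_trans (ltn_ord k))// block_size.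
Qed.

Lemma stretched_upper (s t : unit_interval) delta : `|val s - val t| < delta ->
  3 / 4 <= upper_distribution (@advance R 1) (inl 0%N, s) (inl 0%N, t) delta.
Proof.
move=> dlt; apply: limn_sup_ge; first exact: frequency_bounded.
(* Now j/2 = 2N is even, so block [j] is a plateau at level 0: all its 3 * 4^j times are close, a
   share of at least 3/4. *)
move=> N; pose j := (4 * N)%N.
have jN : (N <= 4 ^ j)%N by apply: leq_trans (ltnW (ltn_expl j _)) => //; rewrite /j; lia.
have lj : level R j = 0.
  rewrite /level; have -> : (j./2 = N.*2)%N by rewrite /j; lia.
  by rewrite odd_double.
have ljj : level R j.+1 = level R j.
  by rewrite /level; have -> : (j.+1./2 = j./2)%N by rewrite /j; lia.
have q0 : (0 < 4 ^ j)%N by rewrite expn_gt0.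
exists (4 ^ j.+1).-1; first by rewrite expnS; lia.
rewrite /frequency ler_pdivlMl ?ltr0n; last by rewrite expnS; lia.
rewrite mulrA ler_pdivrMr// -!natrM ler_nat.
apply: (@leq_trans (3 * 4 ^ j * 4)%N); first by rewrite expnS; lia.
rewrite leq_mul2r/=.
have -> : (3 * 4 ^ j = #|[pred k : 'I_(4 ^ j.+1).-1.+1 | (4 ^ j <= k)%N]|)%N.
  by rewrite card_ord_ge block_size ?leq_exp2l// expnS; lia.
apply: subset_leq_card; apply/fintype.subsetP => k; rewrite !inE => jk.
rewrite stretched_dist (oscillation_plateau ljj); first by rewrite lj addr0 mul1r.
by rewrite jk (leq_trans (ltn_ord k))// block_size.
Qed.

Lemma chaotic_stretched : distributionally_chaotic3 (@advance R 1).
Proof.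
exists [set x | x.1 = inl 0%N]; split.
  move=> cS.
  (* The fibre coordinate maps the set onto [0, 1], whose Lebesgue measure is 1. *)
  have : countable ((fun x : stretched => val x.2) @` [set x | x.1 = inl 0%N]).
    exact: sub_countable (card_image_le _ _) cS.
  have -> : (fun x : stretched => val x.2) @` [set x | x.1 = inl 0%N] =
      `[0, 1]%classic.
    apply/seteqP; split => [_ [x _ <-]|r].
      by rewrite /= in_itv/= unit_interval_itv.
    rewrite /= in_itv/= => r01.
    by exists (inl 0%N, exist (fun y : R => is_true (0 <= y <= 1)) r r01).
  move/countable_lebesgue_measure0; rewrite lebesgue_measure_itv/= lte_fin ltr01.
  by rewrite oppr0 adde0 => /eqP; rewrite onee_eq0.
move=> [i s] [i' t] /= -> -> ne.
have st : 0 < `|val s - val t|.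
  by rewrite normr_gt0 subr_eq0; apply/eqP => /val_inj st; apply: ne; rewrite st.
exists `|val s - val t|, (2 * `|val s - val t|); split=> //; first by lra.
  (* The endpoint 2|s - t| is realised as a distance above the fixed base point of phase 1, where
     the scale factor is 2. *)
  apply: le_trans (le_diameter_stretched (inr (clamp 1), s) (inr (clamp 1), t)).
  rewrite cylinder_mdistE /cylinder_dist /embed/= !subrr !normr0 !add0r.
  by rewrite min_r// max_r// mul1r -mulrBr normrM ger0_norm.
move=> delta /andP[lo hi].
apply: le_lt_trans (stretched_lower hi) _; apply: lt_le_trans (stretched_upper lo).
lra.
Qed.

Lemma advance_dynamical c : dynamical_system (@advance R c).
Proof.
split; [|exact: cylinder_compact|exact: advance_continuous].
by exists (inl 0%N, clamp 0).
Qed.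

End chaos.

Theorem theorem3 (R : realType) :
  exists (X Y : metricType R) (f : X -> X) (F : Y -> Y),
    [/\ dynamical_system f, dynamical_system F, conjugate f F,
        distributionally_chaotic3 F & ~ distributionally_chaotic3 f].
Proof.
exists (cylinder R 0), (cylinder R 1), (@advance R 0), (@advance R 1).
split; [exact: advance_dynamical|exact: advance_dynamical| |
  exact: chaotic_stretched|exact: not_chaotic_flat].
(* Both maps are the same function on the same set, so the identity intertwines them. *)
exists id; split=> //; first exact: continuous_rescale.
by exists id.
Qed.
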